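(* Let $W,Z$ be rays in $V$ with $\mathrm{CS}(W,Z)>0$, and let $P\subset Z^{\uparrow}$, $P\ne\emptyset$. Then $$P^{\vee}=\mathrm{conv}_0(P^{\vee})=\mathrm{conv}_0(P)^{\vee}.$$
   Context: A supertropical semiring is a commutative semiring $R$ such that $e:=1+1$ satisfies $e+e=e$ and, for all $a,b\in R$: $a+b\in\{a,b\}$ if $ea\ne eb$, and $a+b=ea$ if $ea=eb$. Then $eR$ is a bipotent semiring with unit $e$, totally ordered by $a\le b\Leftrightarrow a+b=b$. Assume $eR$ is a nontrivial semifield ($eR\setminus\{0\}\ne\{e\}$). $V$ is an $R$-module with a quadratic pair $(q,b)$: $q:V\to R$ with $q(ax)=a^2q(x)$, and $b:V\times V\to R$ symmetric bilinear with $q(x+y)=q(x)+q(y)+b(x,y)$. Assume $q$ is anisotropic: $q^{-1}(0)=\{0\}$. Rays: $x\sim x'$ in $V\setminus\{0\}$ iff $\lambda x=\mu x'$ for some $\lambda,\mu\in R\setminus\{0\}$; the classes are the rays, $\mathrm{ray}(x)$ is the class of $x$, and $\mathrm{Ray}(V)$ is the set of rays. For $X=\mathrm{ray}(x)$, $Y=\mathrm{ray}(y)$: $[X,Y]=\{\mathrm{ray}(\lambda x+\mu y)\mid\lambda,\mu\in R,\text{ not both }0\}$. A set $A\subset\mathrm{Ray}(V)$ is convex if $[X,Y]\subset A$ for all $X,Y\in A$; $\mathrm{conv}(\cdot)$ denotes the convex hull. The CS-ratio is $\mathrm{CS}(X,Y):=\dfrac{e\,b(x,y)^2}{e\,q(x)q(y)}\in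 eR$ (independent of the choice of $x\in X$, $y\in Y$). For $W=\mathrm{ray}(w)$, $X=\mathrm{ray}(x)$, $Y=\mathrm{ray}(y)$ with $b(w,x),b(w,y)$ not both zero, the $W$-median is $M_W(X,Y):=\mathrm{ray}(b(w,y)x+b(w,x)y)$. For fixed $W,Z$: $Z^{\uparrow}:=\{X\in\mathrm{Ray}(V)\mid\mathrm{CS}(W,X)>\mathrm{CS}(W,Z)\}$. For nonempty $P\subset Z^\uparrow$ the $Z$-polar of $P$ (for $W$) is $P^\vee:=\{Y\in Z^\uparrow\mid M_W(X,Y)=Z\text{ for all }X\in P\}$. For $P\subset Z^\uparrow$, $\mathrm{conv}_0(P):=\mathrm{conv}(P)\cap Z^\uparrow$ (with $\mathrm{conv}_0(\emptyset)=\emptyset$). *)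

(* Defs.v *)
From mathcomp Require Import all_boot all_order all_algebra.
From mathcomp Require Import boolp classical_sets ring.

Set Implicit Arguments.
Unset Strict Implicit.
Unset Printing Implicit Defensive.

Import GRing.Theory.

Local Open Scope classical_set_scope.
Local Open Scope ring_scope.

Section SupertropicalSemiring.
Variable R : comPzSemiRingType.

Definition e : R := 1 + 1.

Definition supertropical : Prop :=
  [/\ e + e = e,
      forall a b : R, e * a <> e * b -> a + b = a \/ a + b = b
    & forall a b : R, e * a = e * b -> a + b = e * a].

(* The ghost ideal eR, with unit e. *)
Definition ghosts : set R := range (fun a : R => e * a).

Definition ghost_semifield : Prop :=
  e <> 0 /\
  forall a, ghosts a -> a <> 0 -> exists2 c, ghosts c & a * c = e.

Definition ghost_nontrivial : Prop := ghosts `\ 0 <> [set e].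

(* The order of eR; only used for elements of eR. *)
Definition gle (a b : R) : Prop := a + b = b.
Definition glt (a b : R) : Prop := gle a b /\ a <> b.

(* The inverse in eR of a nonzero element of eR; such an inverse is unique. *)
Definition ginv (a : R) : R := xget 0 [set c | ghosts c /\ a * c = e].

End SupertropicalSemiring.

Arguments e {R}.

Section QuadraticPair.
Variables (R : comPzSemiRingType) (V : lSemiModType R).

Definition symmetric_bilinear (b : V -> V -> R) : Prop :=
  [/\ forall x y, b x y = b y x,
      forall x y z, b (x + y) z = b x z + b y z
    & forall a x y, b (a *: x) y = a * b x y].

Definition quadratic_pair (q : V -> R) (b : V -> V -> R) : Prop :=
  [/\ forall a x, q (a *: x) = a ^+ 2 * q x,
      symmetric_bilinear b
    & forall x y, q (x + y) = q x + q y + b x y].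

Definition anisotropic (q : V -> R) : Prop := q @^-1` [set 0] = [set 0].

End QuadraticPair.

(* A ray is represented by its set of vectors, a subset of V \ {0}, so that   *)
(* Ray(V) is a set of subsets of V and equality of rays is equality of sets.  *)
Section Rays.
Variables (R : comPzSemiRingType) (V : lSemiModType R).

Definition ray_equiv (x y : V) : Prop :=
  exists l m : R, [/\ l <> 0, m <> 0 & l *: x = m *: y].

(* The class of x for x != 0; ray 0 is not in Ray(V). *)
Definition ray (x : V) : set V := [set y | y <> 0 /\ ray_equiv x y].

Definition Ray : set (set V) := [set ray x | x in [set x | x <> 0]].

(* A chosen vector of the ray X. Everything defined below through repr does   *)
(* not depend on this choice: see segment_ray, CS_ray and median_ray.         *)
Definition repr (X : set V) : V := xget 0 X.

Definition segment (X Y : set V) : set (set V) :=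
  [set L | exists l m : R,
     (l <> 0 \/ m <> 0) /\ L = ray (l *: repr X + m *: repr Y)].

Definition convex (A : set (set V)) : Prop :=
  A `<=` Ray /\ forall X Y, A X -> A Y -> segment X Y `<=` A.

Definition conv (A : set (set V)) : set (set V) := smallest convex A.

Variables (q : V -> R) (b : V -> V -> R).

Definition CS (X Y : set V) : R :=
  let x := repr X in let y := repr Y in
  (e * b x y ^+ 2) * ginv (e * (q x * q y)).

(* Meaningful only when b is nonzero on W x X or on W x Y. *)
Definition median (W X Y : set V) : set V :=
  let w := repr W in let x := repr X in let y := repr Y in
  ray (b w y *: x + b w x *: y).

Definition upset (W Z : set V) : set (set V) :=
  [set X | Ray X /\ glt (CS W Z) (CS W X)].

Definition polar (W Z : set V) (P : set (set V)) : set (set V) :=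
  [set Y | upset W Z Y /\ forall X, P X -> median W X Y = Z].

Definition conv0 (W Z : set V) (P : set (set V)) : set (set V) :=
  conv P `&` upset W Z.

End Rays.

Arguments Ray {R} V.

Section WellDefined.
Variables (R : comPzSemiRingType) (V : lSemiModType R).
Variables (q : V -> R) (b : V -> V -> R).
Hypotheses (hR : supertropical R) (hsf : ghost_semifield R).
Hypotheses (hqb : quadratic_pair q b) (hq : anisotropic q).

Lemma ghost_eq0 (a : R) : e * a = 0 -> a = 0.
Proof.
case: hR => _ _ h ea0; rewrite -[a]addr0 -ea0.
by rewrite h ?ea0 // mulr0.
Qed.

Lemma tropical_mul_neq0 (a c : R) : a <> 0 -> c <> 0 -> a * c <> 0.
Proof.
move=> a0 c0 ac0; apply: c0; apply: ghost_eq0.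
have [|ea0|d _ <-] := hsf.2 (e * a); first by exists a.
  exact/a0/ghost_eq0.
by rewrite -mulrA [d * c]mulrC mulrA -[e * a * c]mulrA ac0 mulr0 mul0r.
Qed.

Lemma tropical_add_eq0 (a c : R) : a + c = 0 -> a = 0.
Proof.
case: hR => _ h1 h2 ac0.
have [eac|neac] := EM (e * a = e * c).
  by apply: ghost_eq0; rewrite -(h2 _ _ eac).
have [<- //|acc] := h1 _ _ neac.
by rewrite -ac0 -[LHS]addr0 -ac0 acc.
Qed.

Lemma q0 (x : V) : q x = 0 -> x = 0.
Proof.
move=> qx; have : (q @^-1` [set 0]) x by [].
by rewrite hq.
Qed.

Lemma q_neq0 (x : V) : x <> 0 -> q x <> 0.
Proof. by move=> x0 /q0. Qed.

Lemma scale_neq0 (a : R) (x : V) : a <> 0 -> x <> 0 -> a *: x <> 0.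
Proof.
move=> a0 x0 ax0.
have := tropical_mul_neq0 (tropical_mul_neq0 a0 a0) (q_neq0 x0); apply.
rewrite -expr2 -(let: And3 h _ _ := hqb in h) ax0.
have : [set (0 : V)] 0 by [].
by rewrite -hq.
Qed.

Lemma lincomb_neq0 (l m : R) (x y : V) :
  l <> 0 \/ m <> 0 -> x <> 0 -> y <> 0 -> l *: x + m *: y <> 0.
Proof.
move=> lm x0 y0 s0.
have lin (u v : V) : u + v = 0 -> u = 0.
  move=> uv0; apply: q0.
  apply: (@tropical_add_eq0 _ (q v + b u v)).
  rewrite addrA -(let: And3 _ _ h := hqb in h) uv0.
  have : [set (0 : V)] 0 by [].
  by rewrite -hq.
case: lm => [l0|m0].
  exact: scale_neq0 l0 x0 (lin _ _ s0).
by rewrite addrC in s0; exact: scale_neq0 m0 y0 (lin _ _ s0).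
Qed.

Lemma ray_equiv_refl (x : V) : ray_equiv x x.
Proof.
have n10 : (1 : R) <> 0.
  by move=> h; apply: hsf.1; rewrite -[e]mulr1 h mulr0.
by exists 1, 1.
Qed.

Lemma ray_equiv_sym (x y : V) : ray_equiv x y -> ray_equiv y x.
Proof. by move=> [l [m [l0 m0 h]]]; exists m, l. Qed.

Lemma ray_equiv_trans (x y z : V) :
  ray_equiv x y -> ray_equiv y z -> ray_equiv x z.
Proof.
move=> [l [m [l0 m0 h]]] [l' [m' [l'0 m'0 h']]].
exists (l' * l), (m * m'); split; [exact: tropical_mul_neq0..|].
by rewrite -[LHS]scalerA h -[RHS]scalerA -h' !scalerA mulrC.
Qed.

Lemma ray_eq (x y : V) : ray_equiv x y -> ray x = ray y.
Proof.
move=> xy; apply/seteqP; split=> z [z0 hz]; split=> //.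
  exact: ray_equiv_trans (ray_equiv_sym xy) hz.
exact: ray_equiv_trans xy hz.
Qed.

Lemma repr_ray (x : V) :
  x <> 0 -> repr (ray x) <> 0 /\ ray_equiv x (repr (ray x)).
Proof.
move=> x0; apply: (@xgetPex _ 0 (ray x)); exists x.
by split=> //; exact: ray_equiv_refl.
Qed.

Lemma segment_ray (x y : V) : x <> 0 -> y <> 0 ->
  segment (ray x) (ray y) =
  [set L | exists l m : R, (l <> 0 \/ m <> 0) /\ L = ray (l *: x + m *: y)].
Proof.
move=> x0 y0; rewrite /segment.
have [rx0 rx] := repr_ray x0; have [ry0 ry] := repr_ray y0.
move: (repr (ray x)) (repr (ray y)) rx ry {x0 y0 rx0 ry0} => x' y' rx ry.
have aux (u u' v v' : V) : ray_equiv u u' -> ray_equiv v v' ->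
    forall l m : R, l <> 0 \/ m <> 0 -> exists l' m' : R,
    (l' <> 0 \/ m' <> 0) /\ ray (l *: u + m *: v) = ray (l' *: u' + m' *: v').
  move=> [a [a' [a0 a'0 ha]]] [c [c' [c0 c'0 hc]]] l m lm.
  exists (c * l * a'), (a * m * c'); split.
    by case: lm => ?; [left|right]; do !apply: tropical_mul_neq0.
  apply: ray_eq; exists (a * c), 1; split; first exact: tropical_mul_neq0.
    by move=> h; apply: hsf.1; rewrite -[e]mulr1 h mulr0.
  rewrite scale1r scalerDr -!scalerA -ha -hc !scalerA.
  by congr (_ *: _ + _ *: _); ring.
apply/seteqP; split=> L [l [m [lm ->]]].
  exact: aux (ray_equiv_sym rx) (ray_equiv_sym ry) _ _ lm.
exact: aux rx ry _ _ lm.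
Qed.

Lemma bilZ (a c : R) (x y : V) : b (a *: x) (c *: y) = a * c * b x y.
Proof.
have [_ [bC _ bZ] _] := hqb.
by rewrite bZ bC bZ bC mulrA.
Qed.

Lemma median_ray (w x y : V) : w <> 0 -> x <> 0 -> y <> 0 ->
  median b (ray w) (ray x) (ray y) = ray (b w y *: x + b w x *: y).
Proof.
move=> /repr_ray[_ rw] /repr_ray[_ rx] /repr_ray[_ ry]; rewrite /median /=.
move: (repr (ray w)) (repr (ray x)) (repr (ray y)) rw rx ry => w' x' y'.
move=> [a [a' [a0 a'0 ha]]] [c [c' [c0 c'0 hc]]] [d [d' [d0 d'0 hd]]].
apply/esym/ray_eq; exists (a * d * c), (a' * d' * c').
split.
- exact: tropical_mul_neq0 (tropical_mul_neq0 a0 d0) c0.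
- exact: tropical_mul_neq0 (tropical_mul_neq0 a'0 d'0) c'0.
have hx : a * c * b w x = a' * c' * b w' x' by rewrite -!bilZ ha hc.
have hy : a * d * b w y = a' * d' * b w' y' by rewrite -!bilZ ha hd.
rewrite !scalerDr !scalerA; congr (_ + _).
  rewrite mulrAC hy -scalerA hc scalerA; congr (_ *: _); ring.
have -> : a * d * c * b w x = a * c * b w x * d by ring.
rewrite hx -scalerA hd scalerA; congr (_ *: _); ring.
Qed.

Lemma ghost_idem : e * e = e :> R.
Proof. by case: hR => h _ _; rewrite {1}/e mulrDl mul1r. Qed.

Lemma ghost_mull (g : R) : ghosts g -> e * g = g.
Proof. by move=> [a _ <-]; rewrite mulrA ghost_idem. Qed.

Lemma ginvP (a : R) :
  a <> 0 -> ghosts (ginv (e * a)) /\ (e * a) * ginv (e * a) = e.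
Proof.
move=> a0; apply: (@xgetPex _ 0 [set c | ghosts c /\ (e * a) * c = e]).
have [|/ghost_eq0//|c gc h] := hsf.2 (e * a); first by exists a.
by exists c.
Qed.

Lemma CS_ray (x y : V) : x <> 0 -> y <> 0 ->
  CS q b (ray x) (ray y) = (e * b x y ^+ 2) * ginv (e * (q x * q y)).
Proof.
move=> x0 y0; rewrite /CS /=.
have [rx0 rx] := repr_ray x0; have [ry0 ry] := repr_ray y0.
move: (repr (ray x)) (repr (ray y)) rx ry rx0 ry0 => x' y'.
move=> [a [a' [a0 a'0 ha]]] [c [c' [c0 c'0 hc]]] x'0 y'0.
have [qZ _ _] := hqb.
have hb : (a * c) ^+ 2 * b x y ^+ 2 = (a' * c') ^+ 2 * b x' y' ^+ 2.
  by rewrite -!exprMn -!bilZ ha hc.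
have hq2 : (a * c) ^+ 2 * (q x * q y) = (a' * c') ^+ 2 * (q x' * q y').
  have -> : (a * c) ^+ 2 * (q x * q y) = (a ^+ 2 * q x) * (c ^+ 2 * q y) by ring.
  by rewrite -!qZ ha hc !qZ; ring.
have m0 : (a' * c') ^+ 2 <> 0.
  have ac0 := tropical_mul_neq0 a'0 c'0.
  exact: (tropical_mul_neq0 ac0 ac0).
have [_] := ginvP m0.
have [] := ginvP (tropical_mul_neq0 (q_neq0 x0) (q_neq0 y0)).
have [] := ginvP (tropical_mul_neq0 (q_neq0 x'0) (q_neq0 y'0)).
move: (ginv (e * (q x' * q y'))) (ginv (e * (q x * q y))) => g' g gg' hg' gg hg.
move: (ginv _) => k hk.
move: (q x * q y) (q x' * q y') (b x y ^+ 2) (b x' y' ^+ 2) hb hq2 hg hg'.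
move: ((a * c) ^+ 2) ((a' * c') ^+ 2) hk => l m hk D D' N N' hb hq2 hg hg'.
have eg := ghost_mull gg; have eg' := ghost_mull gg'.
have -> : e * N' * g' = (m * N') * (e * D * g) * (e * k) * g'.
  rewrite hg -[in LHS]ghost_idem -[X in X * e * N']hk; ring.
rewrite -hb.
have -> : l * N * (e * D * g) * (e * k) * g' = N * e * e * k * g * g' * (l * D).
  by ring.
rewrite hq2.
have -> : N * e * e * k * g * g' * (m * D') = N * (e * m * k) * (e * D' * g') * g.
  by ring.
by rewrite hk hg' -!mulrA eg eg mulrCA eg.
Qed.

End WellDefined.

(* Main.v *)
Require Import Defs.
From mathcomp Require Import all_boot all_order all_algebra.
From mathcomp Require Import boolp classical_sets.

(* A ray X with b(w, X) <> 0 has exactly one representative x with e x = x    *)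
(* and b(w, x) = e. For such representatives M_W(X, Y) = ray(x + y), so that  *)
(* M_W(X, Y) = Z just says x + y = z. For fixed y, the solutions x of this    *)
(* equation are stable under combinations l x1 + m x2 with l + m = e, since   *)
(* y = l y + m y; hence they form a convex set of rays. Thus the polar is the *)
(* trace on the upset of an intersection of convex sets, and, the equation    *)
(* being symmetric, it does not change when P is enlarged to conv0(P).        *)

Import GRing.Theory.

Local Open Scope classical_set_scope.
Local Open Scope ring_scope.

Section Polars.
Set Implicit Arguments.
Unset Strict Implicit.

Variables (R : comPzSemiRingType) (V : lSemiModType R).
Variables (q : V -> R) (b : V -> V -> R).
Hypotheses (hR : supertropical R) (hsf : ghost_semifield R).
Hypotheses (hqb : quadratic_pair q b) (hq : anisotropic q).

(** The reduction to x + y = z is [medianE], which rests on the uniqueness in [normalized_uniq]. By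
    [median_fiber_convex], [conv_median] passes the median relation from a set to its hull. The
    first equality applies this to the polar with X in P held fixed, the second to P with Y in the
    polar held fixed. CS(W, Z) > 0 gives b(w, z) <> 0, hence a normalized z. *)

Lemma conv_sub (A C : set (set V)) : convex C -> A `<=` C -> conv A `<=` C.
Proof. by move=> cC AC X; apply; split. Qed.

Lemma sub_conv (A : set (set V)) : A `<=` conv A.
Proof. by move=> X AX C [_]; apply. Qed.

Lemma ghost_inverse (a : R) : a <> 0 -> exists2 c, ghosts c & c * a = e.
Proof.
move=> a0; have [gc hc] := ginvP hR hsf a0.
exists (ginv (e * a)) => //.
by rewrite -{2}hc -mulrA [a * _]mulrC mulrA (ghost_mull hR gc).
Qed.

Lemma one_neq0 : (1 : R) <> 0.
Proof. by move=> h; apply: hsf.1; rewrite -[e]mulr1 h mulr0. Qed.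

Lemma ray_scale (a : R) (x : V) : a <> 0 -> ray (a *: x) = ray x.
Proof.
move=> a0; apply: (ray_eq hR hsf); exists 1, a.
by split=> //; [exact: one_neq0 | rewrite scale1r].
Qed.

Lemma ray_inj (x y : V) : x <> 0 -> ray x = ray y -> ray_equiv x y.
Proof.
move=> x0 xy; apply: ray_equiv_sym.
suff [] : ray y x by [].
by rewrite -xy; split=> //; exact: ray_equiv_refl.
Qed.

Lemma bilinZr (a : R) (x y : V) : b x (a *: y) = a * b x y.
Proof. by have := bilZ hqb 1 a x y; rewrite scale1r mul1r. Qed.

Lemma bilinDr (x y z : V) : b x (y + z) = b x y + b x z.
Proof. by have [_ [bC bD _] _] := hqb; rewrite bC bD !(bC x). Qed.

Lemma CS_neq0 (w x : V) : w <> 0 -> x <> 0 ->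
  CS q b (ray w) (ray x) <> 0 -> b w x <> 0.
Proof.
move=> w0 x0; rewrite (CS_ray hR hsf hqb hq w0 x0) => h bwx; apply: h.
by rewrite bwx expr2 mulr0 mulr0 mul0r.
Qed.

Lemma glt_neq0 (a c : R) : glt a c -> c <> 0.
Proof.
by rewrite /glt /gle => -[ac nac] c0; apply: nac; rewrite -[LHS]addr0 -[in LHS]c0.
Qed.

Variable w : V.
Hypothesis w0 : w <> 0.

Definition normalized (x : V) : Prop := e *: x = x /\ b w x = e.

Lemma normalized_neq0 x : normalized x -> x <> 0.
Proof.
move=> [_ bx] x0; apply: hsf.1; rewrite -bx x0.
by rewrite -(scale0r (0 : V)) bilinZr mul0r.
Qed.

Lemma normalized_repr x : b w x <> 0 ->
  exists2 x', normalized x' & ray x' = ray x.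
Proof.
move=> bx; have [c gc cb] := ghost_inverse bx.
exists (c *: x); first by rewrite /normalized scalerA (ghost_mull hR gc) bilinZr.
apply: ray_scale => c0.
by apply: hsf.1; rewrite -cb c0 mul0r.
Qed.

(** If l x = m y, applying b(w, _) gives l e = m e. Since e fixes x and y, only these ghost scalars
    matter, and inverting them cancels. *)
Lemma normalized_uniq x y : normalized x -> normalized y ->
  ray x = ray y -> x = y.
Proof.
move=> nx ny /(ray_inj (normalized_neq0 nx)) [l [m [l0 _ lm]]].
case: nx ny => [ex bx] [ey by_].
have elm : l * e = m * e by rewrite -{1}bx -by_ -!bilinZr lm.
have [c _ cl] := ghost_inverse l0.
have cm : c * (m * e) = e by rewrite -elm mulrA cl (ghost_idem hR).
by rewrite -ex -cl -scalerA lm -{1}ey !scalerA -mulrA cm.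
Qed.

Lemma normalizedD x y : normalized x -> normalized y -> normalized (x + y).
Proof.
case: hR => he _ _ [ex bx] [ey by_].
by split; [rewrite scalerDr ex ey | rewrite bilinDr bx by_].
Qed.

Lemma medianE x y z : normalized x -> normalized y -> normalized z ->
  median b (ray w) (ray x) (ray y) = ray z <-> x + y = z.
Proof.
move=> nx ny nz.
rewrite (median_ray hR hsf hqb w0 (normalized_neq0 nx) (normalized_neq0 ny)).
have -> : b w y *: x + b w x *: y = x + y.
  by case: nx ny => [ex ->] [ey ->]; rewrite ex ey.
by split=> [|-> //]; apply: normalized_uniq => //; exact: normalizedD.
Qed.

Definition median_fiber (y z : V) : set (set V) :=
  [set ray x | x in [set x | normalized x /\ x + y = z]].

Lemma median_fiber_convex y z :
  normalized y -> normalized z -> convex (median_fiber y z).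
Proof.
move=> [ey _] [ez _]; split=> [_ [x [nx _] <-]|].
  by exists x => //; exact: normalized_neq0.
move=> _ _ [x1 [n1 h1] <-] [x2 [n2 h2] <-].
rewrite (segment_ray hR hsf (normalized_neq0 n1) (normalized_neq0 n2)).
move=> _ [l [m [lm ->]]].
have lm0 : l + m <> 0.
  move=> h; case: lm; apply; first exact: (tropical_add_eq0 hR h).
  by rewrite addrC in h; exact: (tropical_add_eq0 hR h).
(* Rescaling by c keeps the ray and replaces l, m by the weights c l, c m, whose sum is e. *)
have [c gc ce] := ghost_inverse lm0.
have c0 : c <> 0 by move=> c0; apply: hsf.1; rewrite -ce c0 mul0r.
have [[e1 b1] [e2 b2]] := (n1, n2).
exists (c *: (l *: x1 + m *: x2)); last exact: ray_scale.
split; first split.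
- by rewrite scalerA (ghost_mull hR gc).
- rewrite bilinZr bilinDr !bilinZr b1 b2 -mulrDl mulrA ce.
  exact: (ghost_idem hR).
(* Writing y = c (l y + m y), the sum regroups as c (l (x1 + y) + m (x2 + y)) = c (l + m) z = z. *)
rewrite -{1}ey -ce -scalerA -scalerDr scalerDl addrACA -!scalerDr h1 h2.
by rewrite -scalerDl scalerA ce.
Qed.

Variable z : V.
Hypothesis nz : normalized z.

(** Zero is the least ghost, so the strict inequality forces CS(W, X) <> 0, hence b(w, x) <> 0. *)
Lemma upset_normalized X : upset q b (ray w) (ray z) X ->
  exists2 x, normalized x & X = ray x.
Proof.
move=> [[x /= x0 <-] /glt_neq0/(CS_neq0 w0 x0)/normalized_repr[x' nx' <-]].
by exists x'.
Qed.

Lemma conv_median (A : set (set V)) (y : V) : normalized y ->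
  A `<=` upset q b (ray w) (ray z) ->
  (forall X, A X -> median b (ray w) X (ray y) = ray z) ->
  forall X, conv A X -> median b (ray w) X (ray y) = ray z.
Proof.
move=> ny Aup Amed X convX.
have [x [nx /(medianE nx ny nz) h] <- //] : median_fiber y z X.
apply: conv_sub convX; first exact: median_fiber_convex.
move=> X' AX'; have [x' nx' eX'] := upset_normalized (Aup _ AX').
exists x' => //; split=> //.
by apply/(medianE nx' ny nz); rewrite -eX'; exact: Amed.
Qed.

Lemma medianC (X Y : set V) : median b (ray w) X Y = median b (ray w) Y X.
Proof. by rewrite /median addrC. Qed.

Lemma conv0_polar (P : set (set V)) : P `<=` upset q b (ray w) (ray z) ->
  conv0 q b (ray w) (ray z) (polar q b (ray w) (ray z) P) =
  polar q b (ray w) (ray z) P.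
Proof.
move=> Pup; apply/seteqP; split=> Y; last first.
  by move=> pY; split; [exact: sub_conv | case: pY].
move=> [cY uY]; split=> // X PX.
have [x nx eX] := upset_normalized (Pup _ PX).
(* By symmetry x takes the role of the fixed vector, and Y runs over the hull of the polar. *)
rewrite medianC eX; apply: conv_median cY => // [Y' [] //|Y' [_ h]].
by rewrite medianC -eX; exact: h.
Qed.

Lemma polar_conv0 (P : set (set V)) : P `<=` upset q b (ray w) (ray z) ->
  polar q b (ray w) (ray z) (conv0 q b (ray w) (ray z) P) =
  polar q b (ray w) (ray z) P.
Proof.
move=> Pup; apply/seteqP; split=> Y [uY h]; split=> // X.
  by move=> PX; apply: h; split; [exact: sub_conv | exact: Pup].
move=> [cX _]; have [y ny eY] := upset_normalized uY.
(* Here y is fixed and X runs over the hull of P. *)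
by rewrite eY in h *; exact: conv_median cX.
Qed.

End Polars.

Theorem theorem10p9 (R : comPzSemiRingType) (V : lSemiModType R)
    (q : V -> R) (b : V -> V -> R)
    (hR : supertropical R) (hsf : ghost_semifield R) (hnt : ghost_nontrivial R)
    (hqb : quadratic_pair q b) (hq : anisotropic q)
    (W Z : set V) (hW : Ray V W) (hZ : Ray V Z)
    (hWZ : glt 0 (CS q b W Z))
    (P : set (set V)) (hP : P `<=` upset q b W Z) (hP0 : P !=set0) :
  polar q b W Z P = conv0 q b W Z (polar q b W Z P) /\
  conv0 q b W Z (polar q b W Z P) = polar q b W Z (conv0 q b W Z P).
Proof.
case: hW hZ hWZ hP => w /= w0 <- [z0 /= z00 <-].
move=> /glt_neq0/(CS_neq0 hR hsf hqb hq w0 z00).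
move=> /(normalized_repr hR hsf hqb)[z nz <-] hP.
by rewrite (conv0_polar hR hsf hqb hq) // (polar_conv0 hR hsf hqb hq).
Qed.
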